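(* Let $S$ be a numerical semigroup. Then $S$ is irreducible if and only if $\mathcal{I}_0(S)$ has at most two quarks.
   Context: $\mathbb{N}$ denotes the non-negative integers. A numerical semigroup $S$ is a submonoid of $(\mathbb{N},+)$ with finite complement in $\mathbb{N}$. A numerical semigroup is irreducible if it cannot be expressed as the intersection of two numerical semigroups properly containing it. $\mathcal{I}_0(S)=\{E\subseteq\mathbb{N}: E+S\subseteq E,\ \min(E)=0\}$ is the set of ideals of $S$ with minimum $0$; it is a commutative monoid under $I+J=\{a+b: a\in I, b\in J\}$, with identity $S$, and $S$ is its only unit. (It is isomorphic to the ideal class monoid of $S$, i.e. the monoid of ideals of $S$ modulo translation by integers.) For $I,J\in\mathcal{I}_0(S)$, $I\preceq J$ means $J=I+K$ for some $K\in\mathcal{I}_0(S)$, and $I\prec J$ means $I\preceq J$ and $J\not\preceq I$ (equivalently, $I\preceq J$ and $I\ne J$). A non-unit $Q$ (that is, $Q\neq S$) is a quark if there is no non-unit $J$ with $J\prec Q$. *)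

(* Defs.v *)
From mathcomp Require Import all_boot all_classical.

Set Implicit Arguments.
Unset Strict Implicit.
Unset Printing Implicit Defensive.

Local Open Scope classical_set_scope.

Definition sumset (A B : set nat) : set nat :=
  [set (a + b)%N | a in A & b in B].

Definition numerical_semigroup (S : set nat) : Prop :=
  [/\ S 0%N, sumset S S `<=` S & finite_set (~` S)].

Definition irreducible_semigroup (S : set nat) : Prop :=
  ~ exists S1 S2 : set nat,
      [/\ numerical_semigroup S1, numerical_semigroup S2,
          S `<` S1, S `<` S2 & S = S1 `&` S2].

Definition is_minimum (E : set nat) (m : nat) : Prop :=
  E m /\ forall x, E x -> (m <= x)%N.

Definition ideals0 (S : set nat) : set (set nat) :=
  [set E | sumset E S `<=` E /\ is_minimum E 0].

(* Units of the monoid (ideals0 S, sumset), whose identity is S. *)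
Definition ideal_unit (S I : set nat) : Prop :=
  ideals0 S I /\ exists2 J, ideals0 S J & sumset I J = S.

Definition ideal_le (S I J : set nat) : Prop :=
  exists2 K, ideals0 S K & J = sumset I K.

Definition ideal_lt (S I J : set nat) : Prop :=
  ideal_le S I J /\ ~ ideal_le S J I.

Definition quarks (S : set nat) : set (set nat) :=
  [set Q | [/\ ideals0 S Q, ~ ideal_unit S Q &
    ~ exists J, [/\ ideals0 S J, ~ ideal_unit S J & ideal_lt S J Q]]].

(* Main.v *)
(** A quark is an ideal [Q <> S] all of whose summands are [S] or [Q].  For every
    pseudo-Frobenius number [g], adding [g] to [S] gives a quark.  Let [F] be the
    Frobenius number.  An ideal containing [F] absorbs [F |` S], so [F |` S] is the
    only quark containing [F].  If [S] is irreducible then [F - x] lies in [S] for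
    every gap [x <> F/2], so a quark avoiding [F] must be [F/2 |` S].  If [S] is
    reducible there is a pseudo-Frobenius number [g <> F] with [2g] in [S]; then
    either there is a third pseudo-Frobenius number, or the ideal generated by [0]
    and [F - g] is a quark different from [F |` S] and [g |` S]. *)
Require Import Defs.
From mathcomp Require Import all_boot all_classical.
From mathcomp Require Import zify.

Set Implicit Arguments.
Unset Strict Implicit.
Unset Printing Implicit Defensive.

Local Open Scope classical_set_scope.
Local Open Scope card_scope.

(** * Maxima of bounded sets, and sumsets *)

Lemma exists_max_nat (P : nat -> Prop) (n : nat) :
  (exists x, P x) -> (forall x, P x -> x <= n) ->
  exists m, P m /\ forall x, P x -> x <= m.
Proof.
move=> [x0 Px0] bP.
have ex : exists x, `[< P x >] by exists x0; exact/asboolP.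
have ub : forall x, `[< P x >] -> x <= n by move=> x /asboolP; exact: bP.
case: (ex_maxnP ex ub) => m /asboolP Pm maxm.
by exists m; split=> // x Px; apply: maxm; exact/asboolP.
Qed.

Lemma sumset_subl (I J : set nat) : J 0 -> I `<=` sumset I J.
Proof. by move=> J0 x Ix; exists x => //; exists 0; rewrite ?addn0. Qed.

Lemma sumset_subr (I J : set nat) : I 0 -> J `<=` sumset I J.
Proof. by move=> I0 x Jx; exists 0 => //; exists x; rewrite ?add0n. Qed.

Lemma sumset_mem (I J : set nat) (a b : nat) : I a -> J b -> sumset I J (a + b).
Proof. by move=> Ia Jb; exists a => //; exists b. Qed.

(** As [F] is a natural number, the full semigroup has no Frobenius number here, instead of the
    customary -1. *)
Definition frobenius (S : set nat) (F : nat) : Prop :=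
  ~ S F /\ forall x, F < x -> S x.

Definition pseudo_frobenius (S : set nat) (g : nat) : Prop :=
  ~ S g /\ forall s, S s -> 0 < s -> S (g + s).

Lemma ideals0P (S E : set nat) :
  (forall x s, E x -> S s -> E (x + s)) -> E 0 -> ideals0 S E.
Proof. by move=> ES E0; split=> // _ [x Ex [s Ss <-]]; exact: ES. Qed.

Lemma ideals0_0 (S I : set nat) : ideals0 S I -> I 0.
Proof. by case=> _ []. Qed.

Lemma ideals0_add (S I : set nat) (x s : nat) :
  ideals0 S I -> I x -> S s -> I (x + s).
Proof. by move=> [IS _] Ix Ss; apply: IS; exact: sumset_mem. Qed.

Lemma ideals0_sup (S I : set nat) : ideals0 S I -> S `<=` I.
Proof. by move=> II s Ss; apply: (ideals0_add II (ideals0_0 II) Ss). Qed.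

Section NumericalSemigroup.
Variable S : set nat.
Hypothesis hS : numerical_semigroup S.

Let S0 : S 0. Proof. by case: hS. Qed.

Let SD (a b : nat) : S a -> S b -> S (a + b).
Proof. by move=> Sa Sb; case: hS => _ + _; apply; exact: sumset_mem. Qed.

(** * Units and quarks of the ideal monoid *)

Lemma ideals0_self : ideals0 S S.
Proof. exact: ideals0P. Qed.

Lemma sumset_ideal (I : set nat) : ideals0 S I -> sumset I S = I.
Proof.
move=> II; rewrite eqEsubset; split; first by case: II.
exact: sumset_subl.
Qed.

Lemma ideal_unitE (I : set nat) : ideal_unit S I <-> I = S.
Proof.
split=> [[II [J IJ eS]]|->].
  rewrite eqEsubset; split; last exact: ideals0_sup.
  by rewrite -[X in _ `<=` X]eS; apply: sumset_subl; exact: ideals0_0 IJ.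
split; first exact: ideals0_self.
by exists S; [exact: ideals0_self | exact: (sumset_ideal ideals0_self)].
Qed.

(** Each summand of an ideal is contained in it, so mutual divisibility is equality, and minimality
    becomes a condition on decompositions. *)
Lemma quarksP (Q : set nat) : quarks S Q <->
  [/\ ideals0 S Q, Q <> S & forall I J, ideals0 S I -> ideals0 S J ->
      Q = sumset I J -> I = S \/ I = Q].
Proof.
split=> [[IQ nQ minQ]|[IQ nQ dQ]].
  split=> // [/ideal_unitE//|I J II IJ eQ].
  case: (pselect (I = S)) => [|nI]; [by left|right].
  have [K IK eI] : ideal_le S Q I.
    apply: contrapT => nle; apply: minQ; exists I; split=> //.
      by move/ideal_unitE.
    by split=> //; exists J.
  rewrite eqEsubset; split.
    by rewrite eQ; exact: (sumset_subl (ideals0_0 IJ)).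
  by rewrite eI; exact: (sumset_subl (ideals0_0 IK)).
split=> // [/ideal_unitE//|[I [II nI [[J IJ eQ] nle]]]].
case: (dQ I J II IJ eQ) => [/ideal_unitE//|eI].
apply: nle; exists S; first exact: ideals0_self.
by rewrite sumset_ideal.
Qed.

(** * Gaps and pseudo-Frobenius numbers *)

Lemma gaps_bounded : exists n, forall x, ~ S x -> x <= n.
Proof.
case: hS => _ _ /finite_seqP[s es]; exists (\max_(i <- s) i) => x nSx.
have xs : x \in s by have : (~` S) x by []; rewrite es.
exact: leq_bigmax_seq.
Qed.

Lemma exists_frobenius : S <> setT -> exists F, frobenius S F.
Proof.
move=> nT; have [n bn] := gaps_bounded.
have [|F [nF maxF]] := @exists_max_nat (fun x => ~ S x) n _ bn.
  by apply/existsNP => aS; apply: nT; apply/seteqP; split.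
exists F; split=> // x ltx; apply: contrapT => /maxF; lia.
Qed.

Lemma exists_max_gap (I : set nat) : ideals0 S I -> I <> S ->
  exists g, [/\ I g, ~ S g & forall x, I x -> g < x -> S x].
Proof.
move=> II nI; have [n bn] := gaps_bounded.
have [||g [[Ig nSg] maxg]] := @exists_max_nat (fun x => I x /\ ~ S x) n.
- apply: contrapT => nex; apply: nI; rewrite eqEsubset; split.
    by move=> x Ix; apply: contrapT => nSx; apply: nex; exists x.
  exact: ideals0_sup.
- by move=> x [_ /bn].
exists g; split=> // x Ix ltx; apply: contrapT => nSx.
by have := maxg x (conj Ix nSx); lia.
Qed.

(** The largest gap in [I] works: adding a positive element of [S] stays in [I] but goes beyond that
    gap. *)
Lemma ideal_pseudo_frobenius (I : set nat) : ideals0 S I -> I <> S ->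
  exists2 g, I g & pseudo_frobenius S g.
Proof.
move=> II nI; have [g [Ig nSg maxg]] := exists_max_gap II nI.
exists g => //; split=> // s Ss s0; apply: maxg; last by lia.
exact: ideals0_add II Ig Ss.
Qed.

(** [T] is an ideal of [S], and its largest element outside [S] works: the double lies in [T] and is
    larger. *)
Lemma oversemigroup_special_gap (T : set nat) :
  numerical_semigroup T -> S `<` T ->
  exists g, [/\ T g, pseudo_frobenius S g & S (g + g)].
Proof.
move=> [T0 TT _] [sT nTS].
have TD a b : T a -> T b -> T (a + b).
  by move=> Ta Tb; apply: TT; exact: sumset_mem.
have IT : ideals0 S T by apply: ideals0P => // x s Tx /sT; exact: TD.
have neT : T <> S by move=> e; apply: nTS; rewrite e.
have [g [Tg nSg maxg]] := exists_max_gap IT neT.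
have g0 : 0 < g by case: g nSg {Tg maxg}.
exists g; split=> //; last by apply: maxg; [exact: TD | lia].
split=> // s Ss s0; apply: maxg; last by lia.
by apply: TD => //; exact: sT.
Qed.

(** * Adjoining one gap to the semigroup *)

Lemma ideals0_setU1 (g : nat) : pseudo_frobenius S g -> ideals0 S (g |` S).
Proof.
move=> [_ gS]; apply: ideals0P; last by right.
move=> x s [->|Sx] Ss; last by right; exact: SD.
by case: s Ss => [|s] Ss; [left; rewrite addn0 | right; exact: gS].
Qed.

Lemma setU1_gap_neq (g : nat) : ~ S g -> g |` S <> S.
Proof. by move=> nSg e; apply: nSg; rewrite -e; left. Qed.

(** Every summand lies between [S] and [S] with [g] adjoined, and no set is strictly between
    them. *)
Lemma setU1_quark (g : nat) : pseudo_frobenius S g -> quarks S (g |` S).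
Proof.
move=> pg; have Ig := ideals0_setU1 pg.
apply/quarksP; split=> //; first by apply: setU1_gap_neq; case: pg.
move=> I J II IJ e.
have sI : I `<=` g |` S by rewrite e; exact: (sumset_subl (ideals0_0 IJ)).
case: (pselect (I g)) => [Ig'|nIg]; [right|left]; rewrite eqEsubset; split=> //.
- by move=> x [->//|]; exact: ideals0_sup.
- by move=> x Ix; case: (sI x Ix) => [xg|//]; rewrite xg in Ix.
- exact: ideals0_sup.
Qed.

Lemma setU1_semigroup (g : nat) :
  pseudo_frobenius S g -> S (g + g) -> numerical_semigroup (g |` S).
Proof.
move=> pg Sgg; have Ig := ideals0_setU1 pg; split; first by right.
  move=> _ [a ga [b [->|Sb] <-]]; last exact: ideals0_add Ig ga Sb.
  case: ga => [->|Sa]; first by right.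
  by rewrite addnC; apply: ideals0_add Ig _ Sa; left.
case: hS => _ _; apply: sub_finite_set => x nx Sx.
by apply: nx; right.
Qed.

(** * Quarks of irreducible semigroups *)

Lemma frobenius_pseudo (F : nat) : frobenius S F -> pseudo_frobenius S F.
Proof. by move=> [nF SF]; split=> // s Ss s0; apply: SF; lia. Qed.

Lemma frobenius_gt0 (F : nat) : frobenius S F -> 0 < F.
Proof. by case: F => // -[]. Qed.

(** Otherwise adjoining [g] and adjoining [F] give two proper oversemigroups that intersect in
    [S]. *)
Lemma irreducible_special_gap (F g : nat) : irreducible_semigroup S ->
  frobenius S F -> pseudo_frobenius S g -> S (g + g) -> g = F.
Proof.
move=> irr FF pg Sgg; apply: contrapT => neq; apply: irr.
have F0 := frobenius_gt0 FF.
have pF := frobenius_pseudo FF.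
have ltU x : ~ S x -> S `<` x |` S.
  move=> nSx; split; first by move=> y; right.
  by move=> sub; apply: nSx; apply: sub; left.
exists (g |` S), (F |` S); split.
- exact: setU1_semigroup.
- by apply: setU1_semigroup => //; case: FF => _; apply; lia.
- by apply: ltU; case: pg.
- by apply: ltU; case: FF.
rewrite eqEsubset; split=> [x Sx|x]; first by split; right.
by case=> -[->|//] [|//] /neq.
Qed.

(** The largest violation [m] above F/2 is pseudo-Frobenius by maximality, and its double exceeds
    [F]. Hence [m] is [F], yet F - F = 0 lies in [S]. *)
Lemma irreducible_gap_symmetry (F x : nat) : irreducible_semigroup S ->
  frobenius S F -> x <= F -> ~ S x -> ~ S (F - x) -> x + x = F.
Proof.
move=> irr FF lexF nSx nSFx; apply: contrapT => neq.
pose P y := [/\ F < y + y, y <= F, ~ S y & ~ S (F - y)].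
have [||m [[ltF lemF nSm nSFm] maxm]] := @exists_max_nat P F.
- case: (ltnP F (x + x)) => [lt|le]; first by exists x.
  (* Reflection in F/2 preserves violations, so one lies above F/2. *)
  by exists (F - x); split; rewrite ?subKn //; lia.
- by move=> y [].
have mF : m = F; last by apply: nSFm; rewrite mF subnn.
apply: irreducible_special_gap => //; last by apply: FF.2.
split=> // s Ss s0; apply: contrapT => nSms.
have lems : m + s <= F by rewrite leqNgt; apply/negP => /FF.2.
suff : m + s <= m by lia.
apply: maxm; split=> //; first by lia.
move=> SFms; apply: nSFm.
by have -> : F - m = F - (m + s) + s by [lia]; exact: SD.
Qed.

Lemma quark_frobenius (F : nat) (Q : set nat) :
  frobenius S F -> quarks S Q -> Q F -> Q = F |` S.
Proof.
move=> FF /quarksP[IQ nQ dQ] QF.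
have IF := ideals0_setU1 (frobenius_pseudo FF).
have e : Q = sumset (F |` S) Q.
  rewrite eqEsubset; split; first by apply: sumset_subr; right.
  move=> _ [a Fa [b Qb <-]]; case: Fa => [->|Sa]; last first.
    by rewrite addnC; exact: ideals0_add IQ Qb Sa.
  case: b Qb => [|b] Qb; first by rewrite addn0.
  by apply: (ideals0_sup IQ); apply: FF.2; lia.
by case: (dQ _ _ IF IQ e) => // /setU1_gap_neq; case: FF.
Qed.

(** Only an inclusion: for odd [F] the second set need not be a quark. *)
Lemma irreducible_quarks (F : nat) : irreducible_semigroup S ->
  frobenius S F -> quarks S `<=` [set F |` S; F./2 |` S].
Proof.
move=> irr FF Q qQ.
case: (pselect (Q F)) => [QF|nQF]; [left; exact: quark_frobenius|right].
case/quarksP: qQ => IQ nQ _.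
have half x : Q x -> ~ S x -> x = F./2.
  move=> Qx nSx.
  have lexF : x <= F by rewrite leqNgt; apply/negP => /FF.2.
  suff <- : x + x = F by lia.
  apply: irreducible_gap_symmetry => // SFx; apply: nQF.
  by rewrite -(subnKC lexF); exact: ideals0_add IQ Qx SFx.
have [g Qg [nSg _]] := ideal_pseudo_frobenius IQ nQ.
rewrite /= eqEsubset; split=> [x Qx|x [->|]]; last exact: ideals0_sup.
  by case: (pselect (S x)) => [|/(half x Qx)]; [right | left].
by rewrite -(half g).
Qed.

(** * Three quarks of a reducible semigroup *)

Lemma reducible_special_gap (F : nat) : ~ irreducible_semigroup S ->
  exists g, [/\ pseudo_frobenius S g, S (g + g) & g <> F].
Proof.
move=> /contrapT[S1 [S2 [h1 h2 l1 l2 e]]].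
have [g1 [T1 p1 s1]] := oversemigroup_special_gap h1 l1.
have [g2 [T2 p2 s2]] := oversemigroup_special_gap h2 l2.
case: (pselect (g1 = F)) => [e1|]; last by exists g1.
case: (pselect (g2 = F)) => [e2|]; last by exists g2.
(* If both gaps were [F], it would lie in both oversemigroups, hence in [S]. *)
by case: p1 => nS _; case: nS; rewrite e; split=> //; rewrite e1 -e2.
Qed.

(* The third quark: the ideal generated by [0] and [F - g].  It avoids [F], so when
   [F] and [g] are the only pseudo-Frobenius numbers each of its nontrivial summands
   contains [g]; a complementary summand containing [F - g] would then produce [F]. *)
Lemma two_generated_quark (F g : nat) : frobenius S F ->
  pseudo_frobenius S g -> g <> F ->
  (forall p, pseudo_frobenius S p -> p = F \/ p = g) ->
  quarks S (S `|` [set F - g + s | s in S]).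
Proof.
move=> FF [nSg gS] neq onlyFg.
have legF : g <= F by rewrite leqNgt; apply/negP => /FF.2.
set Q := _ `|` _.
have IQ : ideals0 S Q.
  apply: ideals0P; last by left.
  move=> x s [Sx|[t St <-]] Ss; first by left; exact: SD.
  by right; exists (t + s); [exact: SD | rewrite addnA].
have nSFg : ~ S (F - g).
  by move=> /gS; rewrite subnKC // => SF; apply: FF.1; apply: SF; lia.
have QFg : Q (F - g) by right; exists 0; rewrite ?addn0.
have nQF : ~ Q F.
  case=> [/FF.1//|[s Ss e]]; apply: nSg.
  by have -> : g = s by lia.
apply/quarksP; split=> // [e|I J II IJ e]; first by apply: nSFg; rewrite -e.
case: (pselect (I = S)) => [|nI]; [by left|right].
have sIQ : I `<=` Q by rewrite e; exact: (sumset_subl (ideals0_0 IJ)).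
have sJQ : J `<=` Q by rewrite e; exact: (sumset_subr (ideals0_0 II)).
have Ig : I g.
  have [p Ip pp] := ideal_pseudo_frobenius II nI.
  by case: (onlyFg p pp) Ip => -> // /sIQ.
suff IFg : I (F - g).
  rewrite eqEsubset; split=> // x [|[s Ss <-]]; first exact: ideals0_sup.
  exact: ideals0_add II IFg Ss.
have nJ : ~ J (F - g).
  by move=> JFg; apply: nQF; rewrite e -(subnKC legF); exact: sumset_mem.
(* Elements of [Q] outside [S] are at least F - g, so one of [i], [j] equals F - g; it is not
   [j]. *)
have [i Ii [j Jj eij]] : sumset I J (F - g) by rewrite -e.
case: (sJQ j Jj) => [Sj|[t St et]]; last first.
  by case: nJ; have <- : j = F - g by lia.
case: (sIQ i Ii) => [Si|[t St et]]; first by case: nSFg; rewrite -eij; exact: SD.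
by have <- : i = F - g by lia.
Qed.

Lemma reducible_three_quarks (F : nat) : ~ irreducible_semigroup S ->
  frobenius S F -> exists A B C, [/\ quarks S A, quarks S B, quarks S C &
    [/\ A <> B, A <> C & B <> C]].
Proof.
move=> red FF; have [g [pg Sgg neq]] := reducible_special_gap F red.
have pF := frobenius_pseudo FF.
have inj p q : pseudo_frobenius S p -> p |` S = q |` S -> p = q.
  move=> [nSp _] e; have : (p |` S) p by left.
  by rewrite e; case.
case: (pselect (exists p, [/\ pseudo_frobenius S p, p <> F & p <> g])).
  move=> [p [pp npF npg]]; exists (F |` S), (g |` S), (p |` S).
  split; try exact: setU1_quark.
  split=> e.
  - by apply: neq; rewrite (inj _ _ pF e).
  - by apply: npF; rewrite (inj _ _ pF e).
  - by apply: npg; rewrite (inj _ _ pg e).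
move=> nex.
have onlyFg p : pseudo_frobenius S p -> p = F \/ p = g.
  move=> pp; apply: contrapT => /not_orP[npF npg].
  by apply: nex; exists p.
exists (F |` S), (g |` S), (S `|` [set F - g + s | s in S]).
have legF : g <= F by rewrite leqNgt; apply/negP => /FF.2; exact: pg.1.
split; [exact: setU1_quark | exact: setU1_quark | exact: two_generated_quark |].
have [nSF _] := FF; have [nSg gS] := pg.
split.
- by move=> e; apply: neq; rewrite (inj _ _ pF e).
- move=> e; have : (F |` S) F by left.
  rewrite e => -[//|[s Ss es]]; apply: nSg.
  by have -> : g = s by lia.
(* Either F = 2g, which lies in [S], or F - g is a positive element of [S] and then so is g + (F -
   g) = F. *)
move=> e; have : (g |` S) (F - g).
  by rewrite e; right; exists 0; rewrite ?addn0.
case=> [/= eg|/gS].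
  by apply: nSF; have -> : F = g + g by lia.
by rewrite subnKC // => SF; apply: nSF; apply: SF; lia.
Qed.

End NumericalSemigroup.

(** * Sets with at most two elements, and the conclusion *)

Lemma set2_card_le (T : Type) (a b : T) : [set a; b] #<= `I_2.
Proof.
apply: card_le_trans (card_image_le (fun n => if n == 0 then a else b) `I_2).
by apply: subset_card_le => _ [->|->]; [exists 0 | exists 1].
Qed.

Lemma card_le2_eq (T : Type) (X : set T) (a b c : T) :
  X #<= `I_2 -> X a -> X b -> X c -> [\/ a = b, a = c | b = c].
Proof.
move=> /pcard_leP[f] Xa Xb Xc.
have injf x y : X x -> X y -> f x = f y -> x = y.
  by move=> Xx Xy; apply: (@inj _ _ X f); rewrite inE.
have [fa fb fc] : [/\ f a < 2, f b < 2 & f c < 2] by split; exact: (@funS _ _ X `I_2 f).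
have [e|[e|e]] : f a = f b \/ f a = f c \/ f b = f c by lia.
- by apply: Or31; exact: injf e.
- by apply: Or32; exact: injf e.
- by apply: Or33; exact: injf e.
Qed.

Unset Implicit Arguments.

Theorem theorem5p20 (S : set nat) (hS : numerical_semigroup S) :
  irreducible_semigroup S <-> quarks S #<= `I_2.
Proof.
(* Without gaps, [S] is the only ideal and has no proper oversemigroup, so both sides hold. *)
case: (pselect (S = setT)) => [eT|/(exists_frobenius hS)[F FF]].
  split=> [_|_].
    suff -> : quarks S = set0 by exact: card_ge0.
    apply/seteqP; split=> // Q /(quarksP hS)[IQ nQ _]; apply: nQ.
    by apply/seteqP; split; [rewrite eT | exact: ideals0_sup].
  by move=> [S1 [S2 [_ _ [_ n1] _ _]]]; apply: n1; rewrite eT.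
split=> [irr|card].
  apply: card_le_trans (set2_card_le (F |` S) (F./2 |` S)).
  exact/subset_card_le/irreducible_quarks.
apply: contrapT => red.
have [A [B [C [qA qB qC [AB AC BC]]]]] := reducible_three_quarks hS red FF.
by case: (card_le2_eq card qA qB qC).
Qed.
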